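(* Let $K\subseteq\mathbb{R}^n$ be a non-empty closed set and let $T=\sum_{\alpha\in\mathbb{N}_0^n} q_\alpha\cdot\partial^\alpha$ be a linear map $\mathbb{R}[x_1,\dots,x_n]\to\mathbb{R}[x_1,\dots,x_n]$ with $q_\alpha\in\mathbb{R}[x_1,\dots,x_n]$ for all $\alpha\in\mathbb{N}_0^n$. Then the following are equivalent: (i) $T$ is a $K$-positivity preserver, i.e. $T\,\mathrm{Pos}(K)\subseteq\mathrm{Pos}(K)$; (ii) for every $y\in K$ the sequence $(\alpha!\cdot q_\alpha(y))_{\alpha\in\mathbb{N}_0^n}$ is a $(K-y)$-moment sequence, where $K-y=\{x-y : x\in K\}$. Moreover, if one of these equivalent conditions holds, $y\in K$, and $\mu_y$ is a representing measure of the $(K-y)$-moment sequence $(\alpha!\cdot q_\alpha(y))_{\alpha\in\mathbb{N}_0^n}$, then $(T_yf)(y)=\int f(x+y)\,\mathrm{d}\mu_y(x)$ for all $f\in\mathbb{R}[x_1,\dots,x_n]$, where $T_y:=\sum_{\alpha} q_\alpha(y)\cdot\partial^\alpha$.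
   Context: $\mathrm{Pos}(K)=\{f\in\mathbb{R}[x_1,\dots,x_n] : f\geq 0 \text{ on } K\}$. Every linear map $T:\mathbb{R}[x_1,\dots,x_n]\to\mathbb{R}[x_1,\dots,x_n]$ can be written uniquely as $T=\sum_{\alpha\in\mathbb{N}_0^n} q_\alpha\partial^\alpha$ with polynomial coefficients $q_\alpha$ (on any polynomial the sum is finite). For a closed set $L\subseteq\mathbb{R}^n$, a real sequence $s=(s_\alpha)_{\alpha\in\mathbb{N}_0^n}$ is an $L$-moment sequence if there is a (positive Radon) measure $\mu$ on $\mathbb{R}^n$ with $\mathrm{supp}\,\mu\subseteq L$, all monomials $\mu$-integrable, and $s_\alpha=\int x^\alpha\,\mathrm{d}\mu(x)$ for all $\alpha$; such $\mu$ is called a representing measure of $s$. Here $\alpha!=\alpha_1!\cdots\alpha_n!$ and $\partial^\alpha=\partial_1^{\alpha_1}\cdots\partial_n^{\alpha_n}$. *)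

(* Defs.v *)
From HB Require Import structures.
From mathcomp Require Import all_boot all_order all_algebra.
From mathcomp Require Import all_classical all_reals all_analysis.
From mathcomp Require mpoly.
Import (canonicals, coercions) mpoly.

Set Implicit Arguments.
Unset Strict Implicit.
Unset Printing Implicit Defensive.

Import Order.TTheory GRing.Theory Num.Theory.
Import numFieldNormedType.Exports.
Local Open Scope classical_set_scope.
Local Open Scope ring_scope.

Definition borelRn (R : realType) (n : nat) :=
  g_sigma_algebraType (open : set (set 'rV[R]_n)).

Definition ev (R : realType) (n : nat) (p : mpoly.mpoly n R) (x : 'rV[R]_n) : R :=
  mpoly.meval (fun i => x ord0 i) p.

Definition mono (R : realType) (n : nat) (a : mpoly.multinom n) (x : 'rV[R]_n) : R :=
  \prod_(i < n) x ord0 i ^+ mpoly.fun_of_multinom a i.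

Definition mfact (n : nat) (a : mpoly.multinom n) : nat := (\prod_(i < n) (mpoly.fun_of_multinom a i)`!)%N.

(* T f = \sum_a q_a * d^a f ; only multi-indices with |a| < msize f = deg f + 1
   can contribute, since d^a f = 0 otherwise. *)
Definition Top (R : realType) (n : nat) (q : mpoly.multinom n -> mpoly.mpoly n R)
  (f : mpoly.mpoly n R) : mpoly.mpoly n R :=
  \sum_(a : mpoly.bmultinom n (mpoly.mmeasure mpoly.mdeg f))
     q (mpoly.bmnm a) * mpoly.mderivm (mpoly.bmnm a) f.

Definition Ty (R : realType) (n : nat) (q : mpoly.multinom n -> mpoly.mpoly n R)
  (y : 'rV[R]_n) (f : mpoly.mpoly n R) : mpoly.mpoly n R :=
  \sum_(a : mpoly.bmultinom n (mpoly.mmeasure mpoly.mdeg f))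
     ev (q (mpoly.bmnm a)) y *: mpoly.mderivm (mpoly.bmnm a) f.

Definition Pos (R : realType) (n : nat) (K : set 'rV[R]_n) : set (mpoly.mpoly n R) :=
  [set f | forall x, K x -> 0 <= ev f x].

Definition pos_preserver (R : realType) (n : nat) (K : set 'rV[R]_n)
  (T : mpoly.mpoly n R -> mpoly.mpoly n R) : Prop :=
  forall f, Pos K f -> Pos K (T f).

Definition msupport (R : realType) (n : nat)
  (mu : {measure set (borelRn R n) -> \bar R}) : set 'rV[R]_n :=
  [set x | forall U : set 'rV[R]_n, open U -> U x -> (0 < mu U)%E].

Definition represents (R : realType) (n : nat) (L : set 'rV[R]_n)
  (s : mpoly.multinom n -> R) (mu : {measure set (borelRn R n) -> \bar R}) : Prop :=
  msupport mu `<=` L /\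
  (forall a, mu.-integrable setT (fun x : borelRn R n => (mono a x)%:E)) /\
  (forall a, (s a)%:E = (\int[mu]_x (mono a x)%:E)%E).

Definition is_moment_seq (R : realType) (n : nat) (L : set 'rV[R]_n)
  (s : mpoly.multinom n -> R) : Prop :=
  exists mu : {measure set (borelRn R n) -> \bar R}, represents L s mu.

Definition translate (R : realType) (n : nat) (K : set 'rV[R]_n) (y : 'rV[R]_n) :
  set 'rV[R]_n := [set x - y | x in K].

Definition qseq (R : realType) (n : nat) (q : mpoly.multinom n -> mpoly.mpoly n R)
  (y : 'rV[R]_n) : mpoly.multinom n -> R :=
  fun a => (mfact a)%:R * ev (q a) y.

(* Main.v *)
(* (i) => (ii) is Haviland's theorem for the functional x^a |-> a! q_a(y) on
   K - y: translating by y turns it into p |-> (T p(. - y))(y), so it is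
   nonnegative on Pos(K - y).  For Haviland's theorem, the functional is extended
   by Hahn-Banach to a positive functional Lam on all functions dominated on K by
   a polynomial, continuous or not.  In particular Lam is defined on indicators,
   where it is a finitely additive mass.  Points of R^n are coded by the
   sequence of answers to countably many threshold questions "r <= +- x_i"; the
   mass of the cells cut out by the first k answers is a consistent family, which
   is realised by bits of a point t of [0, Lam 1[ under Lebesgue measure
   (subdividing intervals), without any countable additivity of Lam.  The
   truncated decodings D_k of the bits converge almost everywhere to a random
   point X(t), and Lam f is the limit of Lam (f o D_k) = \int f(D_k(t)) dt, which
   is \int f(X(t)) dt by dominated convergence, for every locally Lipschitz f of
   polynomial growth.  The law of X is the representing measure; applying this to
   bump functions vanishing on K locates its support.
   (ii) => (i) and the integral formula are Taylor's formula, integrated term by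
   term; the complement of the support is negligible because R^n is second
   countable. *)
Require Import Defs.
From HB Require Import structures.
From mathcomp Require Import all_boot all_order all_algebra.
From mathcomp Require Import all_classical all_reals all_analysis.
From mathcomp Require Import measurable_realfun ring lra.
From mathcomp Require mpoly ssrcomplements.
Import (canonicals, coercions) mpoly.

Set Implicit Arguments.
Unset Strict Implicit.
Unset Printing Implicit Defensive.

Import Order.TTheory GRing.Theory Num.Theory.
Import numFieldNormedType.Exports.
Local Open Scope classical_set_scope.
Local Open Scope ring_scope.

(** * Hahn-Banach extension *)

Section HahnBanach.
Context {R : realType} {V : lmodType R} (E : set V).

Definition linear_subspace :=
  [/\ E 0, forall x y, E x -> E y -> E (x + y) & forall a x, E x -> E (a *: x)].

(** Homogeneity is asked only as an inequality for [a > 0]; using it again with [a^-1] turns it into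
    the equality of [sublinear_scale]. *)
Definition sublinear_on (P : V -> R) :=
  (forall x y, E x -> E y -> P (x + y) <= P x + P y) /\
  (forall a x, 0 < a -> E x -> P (a *: x) <= a * P x).

Definition linear_on (P : V -> R) :=
  (forall x y, E x -> E y -> P (x + y) = P x + P y) /\
  (forall a x, E x -> P (a *: x) = a * P x).

Hypothesis subE : linear_subspace.

Let E0 : E 0. Proof. by case: subE. Qed.
Let ED x y : E x -> E y -> E (x + y). Proof. by case: subE => _ + _; apply. Qed.
Let EZ a x : E x -> E (a *: x). Proof. by case: subE => _ _; apply. Qed.
Let EN x : E x -> E (- x). Proof. by rewrite -scaleN1r; apply: EZ. Qed.

Lemma sublinear_opp_ge (P : V -> R) x : sublinear_on P -> E x -> - P (- x) <= P x.
Proof.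
move=> [PD _] Ex; have := PD x (- x) Ex (EN Ex); rewrite subrr.
have := PD 0 0 E0 E0; rewrite addr0; lra.
Qed.

Lemma sublinear_scale (P : V -> R) a x : sublinear_on P -> 0 < a -> E x ->
  P (a *: x) = a * P x.
Proof.
move=> [_ PZ] a0 Ex; apply/eqP; rewrite eq_le PZ //=.
have := PZ a^-1 (a *: x); rewrite invr_gt0 => /(_ a0 (EZ _ Ex)).
by rewrite scalerA mulVf ?gt_eqF // scale1r ler_pdivlMl.
Qed.

(** Serves twice: for the infimum of a chain in Zorn's lemma and for the infimum over [t >= 0] in
    [hahn_banach]. The minorant [l] and the index [i0] make the real [inf] a true infimum instead of
    a default value. *)
Lemma sublinear_inf (I : Type) (i0 : I) (F : I -> V -> R) (l : V -> R) :
  (forall i x, E x -> l x <= F i x) ->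
  (forall i j x y, E x -> E y -> exists k, F k (x + y) <= F i x + F j y) ->
  (forall i a x, 0 < a -> E x -> exists k, F k (a *: x) <= a * F i x) ->
  sublinear_on (fun x => inf (range (F ^~ x))) /\
  forall i x, E x -> inf (range (F ^~ x)) <= F i x.
Proof.
move=> Fl FD FZ.
have infle i x : E x -> inf (range (F ^~ x)) <= F i x.
  by move=> Ex; apply: ge_inf; [exists (l x) => _ [j _ <-]; exact: Fl | exists i].
have leinf c x : (forall i, c <= F i x) -> c <= inf (range (F ^~ x)).
  move=> cF; apply: lb_le_inf; first by exists (F i0 x), i0.
  by move=> _ [i _ <-].
split=> //; split=> [x y Ex Ey|a x a0 Ex].
  rewrite -lerBlDr; apply: (leinf) => i; rewrite lerBlDr -lerBlDl.
  apply: (leinf) => j; rewrite lerBlDl.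
  have [k] := FD i j x y Ex Ey; apply: le_trans; exact/infle/ED.
rewrite -ler_pdivrMl //; apply: (leinf) => i; rewrite ler_pdivrMl //.
have [k] := FZ i a x a0 Ex; apply: le_trans; exact/infle/EZ.
Qed.

Let below (rho P : V -> R) := sublinear_on P /\ forall x, E x -> P x <= rho x.
Let dominated (rho : V -> R) := {P : V -> R | below rho P}.

(** Zorn's lemma for the reversed pointwise order on [E]. A nonempty chain is bounded by its
    pointwise infimum, which is finite because every member is at least [- rho (- x)]. *)
Lemma minimal_sublinear (rho : V -> R) : sublinear_on rho ->
  exists P, [/\ sublinear_on P, forall x, E x -> P x <= rho x &
    forall Q, sublinear_on Q -> (forall x, E x -> Q x <= P x) ->
    forall x, E x -> P x <= Q x].
Proof.
move=> srho.
pose r (s t : dominated rho) := `[< forall x, E x -> sval t x <= sval s x >].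
have rP s t : reflect (forall x, E x -> sval t x <= sval s x) (r s t) by exact: asboolP.
have t0 : dominated rho by exists rho.
have [|s t u|A Atot|[P [sP Prho]] /= Pmin] := @ZL_preorder _ t0 r.
- by move=> t; apply/rP.
- move=> /rP st /rP tu; apply/rP => x Ex; exact: le_trans (tu _ Ex) (st _ Ex).
- have [[s0 As0]|A0] := pselect (A !=set0); last first.
    by exists t0 => s As; exfalso; apply: A0; exists s.
  pose F (i : {s | A s}) := sval (sval i).
  have [sI leI] : sublinear_on (fun x => inf (range (F ^~ x))) /\
      forall i x, E x -> inf (range (F ^~ x)) <= F i x.
    apply: (@sublinear_inf _ (exist _ s0 As0) F (fun x => - rho (- x))).
    - move=> [[P [sP Prho]] AP] x Ex; rewrite /F /=.
      by apply: le_trans (sublinear_opp_ge sP Ex); rewrite lerN2 Prho//; apply: EN.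
    - move=> [s As] [t At] x y Ex Ey; have [/rP st|/rP ts] := Atot s t As At.
        exists (exist _ t At); rewrite /F/=.
        by apply: le_trans (proj1 (proj1 (svalP t)) _ _ Ex Ey) _; rewrite lerD2r st.
      exists (exist _ s As); rewrite /F/=.
      by apply: le_trans (proj1 (proj1 (svalP s)) _ _ Ex Ey) _; rewrite lerD2l ts.
    - move=> [[P [sP Prho]] AP] a x a0 Ex; exists (exist _ _ AP); rewrite /F /=.
      by rewrite (sublinear_scale sP).
  have Irho x : E x -> inf (range (F ^~ x)) <= rho x.
    move=> Ex; apply: le_trans (leI (exist _ s0 As0) x Ex) _.
    exact: (proj2 (svalP s0)).
  exists (exist (below rho) _ (conj sI Irho)) => s As; apply/rP => x Ex /=.
  exact: (leI (exist _ s As)).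
- exists P; split=> // Q sQ QP.
  have Qrho x : E x -> Q x <= rho x.
    by move=> Ex; apply: le_trans (QP x Ex) (Prho x Ex).
  by apply: (elimT (rP _ _) (Pmin (exist (below rho) Q (conj sQ Qrho)) _)); apply/rP.
Qed.

(* A minimal sublinear [P] is additive: [y |-> inf_(t >= 0) P (y + t x) - t P x]
   is sublinear and below [P], hence above it, and [t = 1] gives
   [P y + P x <= P (y + x)]. *)
Lemma hahn_banach (rho : V -> R) : sublinear_on rho ->
  exists2 P, linear_on P & forall x, E x -> P x <= rho x.
Proof.
move=> /minimal_sublinear[P [sP Prho Pmin]].
have PD x y : E x -> E y -> P (x + y) = P x + P y.
  move=> Ex Ey; apply/eqP; rewrite eq_le (proj1 sP) //=.
  pose F (t : {t : R | 0 <= t}) z := P (z + sval t *: x) - sval t * P x.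
  have PZ t : 0 <= t -> t * P x <= P (t *: x).
    rewrite le_eqVlt => /orP[/eqP <-|t0]; last by rewrite (sublinear_scale sP).
    rewrite mul0r scale0r; have := (proj1 sP) 0 0 E0 E0; rewrite addr0; lra.
  have z0 : 0 <= 0 :> R by [].
  have [sF leF] : sublinear_on (fun x => inf (range (F ^~ x))) /\
      forall i x, E x -> inf (range (F ^~ x)) <= F i x.
    (* The minorant comes from [t * P x <= P (t *: x) <= P (z + t *: x) + P (- z)]. *)
    apply: (@sublinear_inf _ (exist _ 0 z0) F (fun z => - P (- z))).
    - move=> [t t0] z Ez; rewrite /F /=.
      have := (proj1 sP) (z + t *: x) (- z) (ED Ez (EZ _ Ex)) (EN Ez).
      rewrite addrAC subrr add0r; have := PZ t t0; lra.
    - move=> [t t0] [s s0] z w Ez Ew; exists (exist _ (t + s) (addr_ge0 t0 s0)).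
      rewrite /F /= scalerDl addrACA mulrDl opprD [leRHS]addrACA lerD2r.
      by apply: (proj1 sP); apply: ED => //; apply: EZ.
    - move=> [t t0] a z a0 Ez; exists (exist _ (a * t) (mulr_ge0 (ltW a0) t0)).
      rewrite /F /= -scalerA -scalerDr (sublinear_scale sP) //.
        by rewrite mulrBr mulrA.
      by apply: ED => //; apply: EZ.
  have leP z : E z -> inf (range (F ^~ z)) <= P z.
    by move=> Ez; have := leF (exist _ 0 z0) z Ez; rewrite /F/= scale0r addr0 mul0r subr0.
  have := Pmin _ sF leP y Ey.
  have := leF (exist _ 1 ler01) y Ey.
  rewrite /F /= scale1r mul1r addrC [y + x]addrC; lra.
exists P => //; split=> // a x Ex.
have P0 : P 0 = 0 by have := PD 0 0 E0 E0; rewrite addr0; lra.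
have PN z : E z -> P (- z) = - P z.
  by move=> Ez; have := PD z (- z) Ez (EN Ez); rewrite subrr P0; lra.
have [a0|a0|->] := ltgtP a 0; last by rewrite scale0r mul0r.
  rewrite -[a]opprK scaleNr PN; last exact: EZ.
  by rewrite (sublinear_scale sP) ?mulNr // oppr_gt0.
by rewrite (sublinear_scale sP).
Qed.

End HahnBanach.

(** * Extension of positive functionals from polynomials to dominated functions *)

Section PositiveExtension.
Context {R : realType} {n : nat}.
Implicit Types (K : set 'rV[R]_n) (p : mpoly.mpoly n R) (f g : 'rV[R]_n -> R^o).

Lemma evD p q x : ev (p + q) x = ev p x + ev q x.
Proof. exact: mpoly.mevalD. Qed.

Lemma evZ a p x : ev (a *: p) x = a * ev p x.
Proof. exact: mpoly.mevalZ. Qed.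

Lemma evM p q x : ev (p * q) x = ev p x * ev q x.
Proof. exact: mpoly.mevalM. Qed.

Lemma evN p x : ev (- p) x = - ev p x.
Proof. exact: mpoly.mevalN. Qed.

Lemma ev0 x : ev (0 : mpoly.mpoly n R) x = 0.
Proof. exact: mpoly.meval0. Qed.

Lemma ev1 x : ev (1 : mpoly.mpoly n R) x = 1.
Proof. exact: mpoly.meval1. Qed.

(** The bound is required on [K] only, and no regularity is asked, so that indicators of arbitrary
    sets belong to this space. *)
Definition dominated K : set ('rV[R]_n -> R^o) :=
  [set f | exists p, forall x, K x -> `|f x| <= ev p x].

Lemma linear_subspace_dominated K : linear_subspace (dominated K).
Proof.
split=> [|f g [p fp] [q gq]|a f [p fp]].
- by exists 0 => x _; rewrite ev0 normr0.
- exists (p + q) => x Kx; rewrite evD.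
  by apply: le_trans (ler_normD _ _) _; rewrite lerD ?fp ?gq.
- exists (`|a| *: p) => x Kx; rewrite evZ normrM.
  by rewrite ler_wpM2l ?fp.
Qed.

Lemma dominated_le K f g : dominated K g -> (forall x, K x -> `|f x| <= `|g x|) ->
  dominated K f.
Proof.
by move=> [p gp] fg; exists p => x Kx; apply: le_trans (fg x Kx) (gp x Kx).
Qed.

Lemma dominated_ev K p : dominated K (ev p).
Proof.
exists (1 + p * p) => x _; rewrite evD ev1 evM.
rewrite ler_norml; apply/andP; split; nra.
Qed.

Definition positive_on K (Lam : ('rV[R]_n -> R^o) -> R) :=
  linear_on (dominated K) Lam /\
  forall f, dominated K f -> (forall x, K x -> 0 <= f x) -> 0 <= Lam f.

(** Hahn-Banach for [rho f], the infimum of [L p] over the polynomials [p] above [f] on [K]. A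
    linear functional below [rho] agrees with [L] on polynomials, as one sees from [p] and [- p],
    and it is positive because [f >= 0] puts [- f] below the polynomial 0. *)
Lemma positive_extension K (L : mpoly.mpoly n R -> R) :
  (forall p q, L (p + q) = L p + L q) -> (forall a p, L (a *: p) = a * L p) ->
  (forall p, Pos K p -> 0 <= L p) ->
  exists2 Lam, positive_on K Lam & forall p, Lam (ev p) = L p.
Proof.
move=> LD LZ L_ge0.
have sE := linear_subspace_dominated K; have [E0 ED EZ] := sE.
have L0 : L 0 = 0 by have := LZ 0 0; rewrite scale0r mul0r.
have LN p : L (- p) = - L p by rewrite -scaleN1r LZ mulN1r.
have Lle p q : (forall x, K x -> ev p x <= ev q x) -> L p <= L q.
  move=> pq; rewrite -subr_ge0 -LN -LD; apply: L_ge0 => x Kx.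
  by rewrite evD evN subr_ge0 pq.
pose above f := [set L p | p in [set p | forall x, K x -> f x <= ev p x]].
pose rho f := inf (above f).
have above_lb f p : (forall x, K x -> - ev p x <= f x) -> lbound (above f) (- L p).
  move=> pf _ [q fq <-]; rewrite -LN; apply: Lle => x Kx.
  by rewrite evN; apply: le_trans (pf x Kx) (fq x Kx).
have domN f : dominated K f ->
    exists p, (forall x, K x -> f x <= ev p x) /\ (forall x, K x -> - ev p x <= f x).
  by move=> [p fp]; exists p; split=> x /fp; rewrite ler_norml => /andP[].
have rho_le f p : dominated K f -> (forall x, K x -> f x <= ev p x) -> rho f <= L p.
  move=> /domN[q [_ qf]] fp; apply: ge_inf; last by exists p.
  by exists (- L q); exact: above_lb.
have rho_ge f c : dominated K f ->
    (forall p, (forall x, K x -> f x <= ev p x) -> c <= L p) -> c <= rho f.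
  move=> /domN[q [fq _]] cf; apply: lb_le_inf; first by exists (L q), q.
  by move=> _ [p fp <-]; exact: cf.
have srho : sublinear_on (dominated K) rho.
  split=> [f g Ef Eg|a f a0 Ef].
    rewrite -lerBlDr; apply: (rho_ge) => // p fp; rewrite lerBlDr -lerBlDl.
    apply: (rho_ge) => // q gq; rewrite lerBlDl -LD; apply: (rho_le); first exact: ED.
    by move=> x Kx; rewrite evD lerD ?fp ?gq.
  rewrite -ler_pdivrMl //; apply: (rho_ge) => // p fp; rewrite ler_pdivrMl // -LZ.
  apply: (rho_le); first exact: EZ.
  by move=> x Kx; rewrite evZ ler_pM2l // fp.
have [Lam LamL Lamrho] := hahn_banach sE srho.
have LamN f : dominated K f -> Lam (- f) = - Lam f.
  by move=> Ef; rewrite -scaleN1r (proj2 LamL) // mulN1r.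
exists Lam => [|p].
  split=> // f Ef f_ge0; rewrite -oppr_le0 -LamN //.
  have EN : dominated K (- f) by rewrite -scaleN1r; exact: EZ.
  apply: le_trans (Lamrho _ EN) _; rewrite -L0; apply: (rho_le) => // x Kx.
  by rewrite ev0 oppr_le0 f_ge0.
have Lamle q : Lam (ev q) <= L q.
  by apply: le_trans (Lamrho _ (dominated_ev K q)) _; apply: (rho_le) => //; exact: dominated_ev.
apply/eqP; rewrite eq_le Lamle /= -lerN2 -LN -LamN; last exact: dominated_ev.
rewrite (_ : - ev p = ev (- p)) //; apply/funext => x.
by rewrite evN.
Qed.

End PositiveExtension.

(** * A finitely additive mass as the law of a random sequence of bits *)

Section RandomBits.
Context {R : realType} {T : Type} (A : nat -> set T) (m : set T -> R).

Fixpoint cell (w : nat -> bool) (k : nat) : set T :=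
  if k is k'.+1 then
    if w k' then cell w k' `&` A k' else cell w k' `\` A k'
  else setT.

(* The cells of level [k] are laid side by side on [[0, m setT[] in an order that
   refines as [k] grows; [cell_left w k] is the left end of the interval of
   [cell w k], whose length is [m (cell w k)]. *)
Fixpoint cell_left (w : nat -> bool) (k : nat) : R :=
  if k is k'.+1 then
    if w k' then cell_left w k' else cell_left w k' + m (cell w k' `&` A k')
  else 0.

(** Descends the tree of cells: for [t] in [[0, m setT[] the state is the cell whose interval
    contains [t], with the left end of that interval. The part of the cell inside [A k] occupies the
    left piece. *)
Fixpoint bit_state (t : R) (k : nat) : set T * R :=
  if k is k'.+1 then
    let: (C, a) := bit_state t k' in
    if t < a + m (C `&` A k') then (C `&` A k', a)
    else (C `\` A k', a + m (C `&` A k'))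
  else (setT, 0).

Definition bit (t : R) (k : nat) : bool :=
  t < (bit_state t k).2 + m ((bit_state t k).1 `&` A k).

Definition word (w : seq bool) (i : nat) : bool := nth false w i.

Definition agree k (v w : nat -> bool) : bool := [forall i : 'I_k, v i == w i].

Lemma agreeP k v w : reflect (forall i, (i < k)%N -> v i = w i) (agree k v w).
Proof.
apply: (iffP forallP) => [vw i ik|vw i]; last by rewrite vw.
exact/eqP/(vw (Ordinal ik)).
Qed.

Lemma agreeS k v w : agree k.+1 v w = agree k v w && (v k == w k).
Proof.
apply/agreeP/andP => [vw|[/agreeP vw /eqP vwk] i].
  by split; [apply/agreeP => i ik; apply: vw; exact: ltnW|rewrite vw].
by rewrite ltnS leq_eqVlt => /orP[/eqP->|/vw].
Qed.

(** Writes a function of the first [k] bits as a finite combination of indicators of words. It is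
    applied both to the bits of [t], to integrate, and to the code of [x], to compute [Lam]. *)
Lemma sum_agree k (G : (nat -> bool) -> R) v :
  (forall v w, agree k v w -> G v = G w) ->
  \sum_(w : k.-tuple bool) G (word w) * (agree k v (word w))%:R = G v.
Proof.
move=> GE; pose w0 := [tuple v i | i < k].
have w0E i : (i < k)%N -> word w0 i = v i.
  move=> ik; rewrite /word (_ : i = Ordinal ik) // -tnth_nth tnth_mktuple //.
have aw0 : agree k v (word w0) by apply/agreeP => i ik; rewrite w0E.
rewrite (bigD1 w0) //= aw0 mulr1 big1 ?addr0 => [|w ww0].
  by rewrite -(GE _ _ aw0).
rewrite (_ : agree k v (word w) = false) ?mulr0 //.
apply: contraNF ww0 => /agreeP vw; apply/eqP/eq_from_tnth => i.
by rewrite tnth_mktuple (tnth_nth false) -/(word w i) vw.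
Qed.

Lemma cellP w k x : cell w k x <-> agree k (fun i => `[< A i x >]) w.
Proof.
elim: k => [|k IH] /=; first by split=> // _; apply/agreeP.
rewrite agreeS; case: (w k); split.
- by move=> [/IH -> /asboolP ->].
- by move=> /andP[/IH cx /eqP/asboolP].
- by move=> [/IH -> nA]; apply/eqP/asboolPn.
- by move=> /andP[/IH cx /eqP/negbT/asboolPn].
Qed.

Lemma eq_cell k v w : agree k v w -> cell v k = cell w k.
Proof.
elim: k => //= k IH; rewrite agreeS => /andP[/IH -> /eqP ->] //.
Qed.

Lemma eq_cell_left k v w : agree k v w -> cell_left v k = cell_left w k.
Proof.
elim: k => //= k IH; rewrite agreeS => /andP[vw /eqP ->] //.
by rewrite IH // (eq_cell vw).
Qed.

Lemma bit_stateE t k : bit_state t k = (cell (bit t) k, cell_left (bit t) k).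
Proof.
elim: k => //= k IH; rewrite [bit t k]/bit IH /=.
by case: ifP.
Qed.

Lemma bitE t k : bit t k = (t < cell_left (bit t) k + m (cell (bit t) k `&` A k)).
Proof. by rewrite {1}/bit bit_stateE. Qed.

Lemma agree_bitS w t k : agree k.+1 (bit t) w =
  agree k (bit t) w && ((t < cell_left w k + m (cell w k `&` A k)) == w k).
Proof.
rewrite agreeS; apply: andb_id2l => tw.
by rewrite bitE (eq_cell tw) (eq_cell_left tw).
Qed.

Lemma measurable_agree_bit w k :
  measurable ([set t | agree k (bit t) w] : set (measurableTypeR R)).
Proof.
elim: k => [|k IH].
  by rewrite (_ : [set _ | _] = setT) //; apply/seteqP; split=> // t _; apply/agreeP.
set b := cell_left w k + m (cell w k `&` A k).
rewrite (_ : [set _ | _] = [set t | agree k (bit t) w] `&`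
  (if w k then [set` `]-oo, b[] else [set` `[b, +oo[])); last first.
  apply/seteqP; split=> t /=; rewrite agree_bitS -/b.
    move=> /andP[-> /eqP tb]; split=> //; move: tb; case: (w k) => /= tb.
      by rewrite in_itv /= tb.
    by rewrite in_itv /= andbT leNgt tb.
  move=> [-> /=]; case: (w k) => /=; rewrite in_itv /= ?andbT.
    by move=> ->.
  by rewrite leNgt => /negbTE ->.
by apply: measurableI => //; case: ifP.
Qed.

Hypothesis m_ge0 : forall C, 0 <= m C.
Hypothesis mD : forall C B, m C = m (C `&` B) + m (C `\` B).

(** By induction: the cut point of level [k] splits the interval of [cell w k] into two pieces whose
    lengths add up by [mD], and [m_ge0] keeps the cut point inside the interval. *)
Lemma agree_bit_itv w k :
  `[0, m setT[%classic `&` [set t | agree k (bit t) w] =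
  `[cell_left w k, cell_left w k + m (cell w k)[%classic.
Proof.
elim: k => [|k IH].
  by rewrite /= add0r; apply/seteqP; split=> t /= => [[]|tw] //; split=> //; apply/agreeP.
set b := cell_left w k + m (cell w k `&` A k).
rewrite (_ : [set t | _] = [set t | agree k (bit t) w] `&`
   [set t | (t < b) == w k]); last first.
  by apply/seteqP; split=> t /=; rewrite agree_bitS -/b => /andP.
rewrite setIA IH; have := mD (cell w k) (A k).
have := m_ge0 (cell w k `&` A k); have := m_ge0 (cell w k `\` A k).
rewrite /b /=; case: (w k) => m1 m2 m3.
  apply/seteqP; split=> t /=; rewrite !in_itv /=.
    by move=> [/andP[-> _] /eqP].
  by move=> /andP[-> tb]; rewrite tb; split=> //; apply: lt_le_trans tb _; lra.
apply/seteqP; split=> t /=; rewrite !in_itv /=.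
  move=> [/andP[_ ?] /eqP/negbT]; rewrite -leNgt => -> /=; lra.
move=> /andP[bt tb]; split; first lra.
by apply/eqP/negbTE; rewrite -leNgt.
Qed.

Definition bit_measure :=
  mrestr (@lebesgue_measure R) (measurable_itv `[0, m setT[).

HB.instance Definition _ := Measure.on bit_measure.

Lemma bit_measure_agree w k :
  bit_measure [set t | agree k (bit t) w] = (m (cell w k))%:E.
Proof.
rewrite /bit_measure /mrestr setIC agree_bit_itv lebesgue_measure_itv /= lte_fin ltrDl.
(* An empty interval has measure 0; the mass of the cell is then both nonpositive and
   nonnegative. *)
case: ltP => [_|m0]; first by rewrite -EFinB addrAC subrr add0r.
by congr EFin; apply/eqP; rewrite eq_le m_ge0.
Qed.

Lemma sum_agree_bit k (G : (nat -> bool) -> R) :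
  (forall v w, agree k v w -> G v = G w) ->
  (fun t : measurableTypeR R => G (bit t)) = fun t => \sum_(w <- enum {: k.-tuple bool})
    G (word w) * \1_[set t | agree k (bit t) (word w)] t.
Proof.
move=> GE; apply/funext => t; rewrite -[LHS](sum_agree _ GE) big_enum /=.
by apply: eq_bigr => w _; rewrite indicE mem_setE.
Qed.

Lemma measurable_fun_bit k (G : (nat -> bool) -> R) :
  (forall v w, agree k v w -> G v = G w) ->
  measurable_fun setT (fun t : measurableTypeR R => G (bit t)).
Proof.
move=> /sum_agree_bit ->.
apply: measurable_sum => w; apply: measurable_funM => //.
apply: measurable_indic; exact: measurable_agree_bit.
Qed.

Lemma integral_bit k (G : (nat -> bool) -> R) :
  (forall v w, agree k v w -> G v = G w) ->
  (\int[bit_measure]_t (G (bit t))%:E =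
   (\sum_(w : k.-tuple bool) G (word w) * m (cell (word w) k))%:E)%E.
Proof.
move=> GE.
have ind_int (w : k.-tuple bool) : bit_measure.-integrable setT
    (EFin \o \1_[set t | agree k (bit t) (word w)]).
  have mA := measurable_agree_bit (word w) k.
  apply/integrableP; split; first exact/measurable_EFinP/measurable_indic.
  under eq_integral => t _ do rewrite /= indicE normr_nat -indicE.
  by rewrite integral_indic // setIT /= bit_measure_agree ltry.
under eq_integral do
  rewrite -[G _]/((fun t => G (bit t)) _) (sum_agree_bit GE) -sumEFin.
rewrite integral_sum //; last first.
  by move=> w; under eq_fun do rewrite EFinM; apply: integrableZl => //; exact: ind_int.
rewrite big_enum -sumEFin; apply: eq_bigr => w _.
under eq_integral do rewrite EFinM.
rewrite integralZl //; last exact: ind_int.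
by rewrite integral_indic //= ?setIT ?bit_measure_agree //; exact: measurable_agree_bit.
Qed.

End RandomBits.

(** * Coding the points of R^n by bits *)

Section Thresholds.
Context {R : realType} {n : nat}.
Implicit Types (x z u v : 'rV[R]_n) (w : nat -> bool) (i : 'I_n) (s : bool).

Definition side s (a : R) : R := if s then a else - a.

(** Enumerates coordinate, sign and rational [l / (d + 1)]. An index that codes no question gets the
    trivial set [setT] and the value 0, which leaves the nonnegative [part] unchanged. *)
Definition threshold (j : nat) : option ('I_n * bool * nat * nat) := unpickle j.

Definition threshold_set (j : nat) : set 'rV[R]_n :=
  if threshold j is Some (i, s, l, d) then [set x | l%:R / d.+1%:R <= side s (x ord0 i)]
  else setT.

Definition threshold_value (j : nat) i s : R :=
  if threshold j is Some (i', s', l, d) then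
    if (i' == i) && (s' == s) then l%:R / d.+1%:R else 0
  else 0.

(* The largest threshold answered positively among the first [k]: hence
   [approx_pt (code x) k] rounds the coordinates of [x] towards 0, and the
   positive and negative parts separately increase with [k]. *)
Fixpoint part w (k : nat) i s : R :=
  if k is k'.+1 then
    if w k' then Num.max (part w k' i s) (threshold_value k' i s) else part w k' i s
  else 0.

Definition approx_pt w k : 'rV[R]_n := \row_i (part w k i true - part w k i false).

(** A bit sequence that codes no point may have both parts positive. Their sum still increases with
    [k] and bounds the approximations, as monotone and dominated convergence require. *)
Definition envelope w k : 'rV[R]_n := \row_i (part w k i true + part w k i false).

Definition code x (j : nat) : bool := `[< threshold_set j x >].

Lemma eq_part k w w' i s : agree k w w' -> part w k i s = part w' k i s.
Proof.
by elim: k => //= k IH; rewrite agreeS => /andP[/IH -> /eqP ->].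
Qed.

Lemma part_ge0 w k i s : 0 <= part w k i s.
Proof. by elim: k => //= k IH; case: ifP => // _; rewrite le_max IH. Qed.

Lemma part_nd w i s : nondecreasing_seq (fun k => part w k i s).
Proof.
apply/nondecreasing_seqP => k /=; case: ifP => // _.
by rewrite le_max lexx.
Qed.

Lemma part_code_le x k i s : part (code x) k i s <= Num.max 0 (side s (x ord0 i)).
Proof.
elim: k => [|k IH] /=; first by rewrite le_max lexx.
case: ifP => // /asboolP; rewrite ge_max IH /= /threshold_value /threshold_set.
case: threshold => [[[[i' s'] l] d]|_]; last by rewrite le_max lexx.
case: ifP => [/andP[/eqP-> /eqP->] /= ?|_ _]; rewrite le_max ?lexx //.
by apply/orP; right.
Qed.

Lemma part_code_ge x k i s l d :
  (pickle (i, s, l, d) < k)%N -> l%:R / d.+1%:R <= side s (x ord0 i) ->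
  l%:R / d.+1%:R <= part (code x) k i s.
Proof.
move=> jk lx; apply: le_trans (part_nd _ _ _ jk) => /=.
rewrite /code /threshold_set /threshold_value /threshold pickleK asboolT //.
by rewrite !eqxx le_max lexx orbT.
Qed.

Lemma envelope_code_le x k i : envelope (code x) k ord0 i <= `|x ord0 i|.
Proof.
rewrite mxE; have := part_code_le x k i true; have := part_code_le x k i false.
rewrite /side; have [x0|x0] := ler0P (x ord0 i); rewrite ?maxEle; repeat case: ifP; lra.
Qed.

Lemma normr_approx_le w k i : `|approx_pt w k ord0 i| <= envelope w k ord0 i.
Proof.
rewrite !mxE; have := part_ge0 w k i true; have := part_ge0 w k i false.
by rewrite ler_norml; move=> ? ?; apply/andP; split; lra.
Qed.

(** Rounding towards 0 keeps the approximation between 0 and the coordinate. This crude bound serves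
    for large coordinates. *)
Lemma approx_code_err x k i : `|approx_pt (code x) k ord0 i - x ord0 i| <= `|x ord0 i|.
Proof.
rewrite mxE; have := part_code_le x k i true; have := part_code_le x k i false.
have := part_ge0 (code x) k i true; have := part_ge0 (code x) k i false.
rewrite /side ler_norml; have [x0|x0] := ler0P (x ord0 i); rewrite ?maxEle;
  repeat case: ifP; move=> *; apply/andP; split; lra.
Qed.

(** Once all questions with denominator [d + 1] and numerator at most [l] have been asked, the grid
    point just below the size of the coordinate has been accepted. *)
Lemma approx_code_grid (l d : nat) : exists k0, forall k, (k0 <= k)%N -> forall x i,
  `|x ord0 i| <= l%:R / d.+1%:R ->
  `|approx_pt (code x) k ord0 i - x ord0 i| <= d.+1%:R^-1.
Proof.
(* A sum of successors exceeds each of the finitely many indices concerned. *)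
pose k0 := (\sum_(c : 'I_n * bool * 'I_l.+1)
  (pickle (c.1.1, c.1.2, nat_of_ord c.2, d)).+1)%N.
exists k0 => k k0k x i xl.
have d0 : 0 < d.+1%:R :> R by rewrite ltr0n.
have near s : 0 <= side s (x ord0 i) ->
    side s (x ord0 i) - d.+1%:R^-1 <= part (code x) k i s.
  set a := side s _ => a0.
  have ad0 : 0 <= a * d.+1%:R by rewrite mulr_ge0 // ltW.
  have /andP[] := truncn_itv ad0; set e := Num.truncn _ => ea ae.
  have el : (e < l.+1)%N.
    rewrite ltnS -(ler_nat R); apply: le_trans ea _.
    rewrite -ler_pdivlMr //; apply: le_trans xl; rewrite /a /side.
    by case: (s); rewrite ?ler_norm // -normrN ler_norm.
  have ek : (pickle (i, s, e, d) < k)%N.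
    apply: leq_trans k0k; rewrite /k0 (bigD1 (i, s, Ordinal el)) //=.
    exact: leq_addr.
  have ea' : e%:R / d.+1%:R <= a by rewrite ler_pdivrMr.
  apply: le_trans (part_code_ge ek ea').
  rewrite lerBlDr -[X in _ <= _ + X]mul1r -mulrDl ler_pdivlMr //.
  by rewrite natr1 ltW.
have := part_code_le x k i true; have := part_code_le x k i false.
have := part_ge0 (code x) k i true; have := part_ge0 (code x) k i false.
have : 0 < d.+1%:R^-1 :> R by rewrite invr_gt0.
move: near; set D := d.+1%:R^-1 => near.
have := near true; have := near false; rewrite mxE /side ler_norml.
have [x0|/ltW x0] := lerP (x ord0 i) 0.
  rewrite (max_idPr _) ?oppr_ge0 // => /(_ x0) ? _ *.
  by apply/andP; split; lra.
rewrite (max_idPl _) ?oppr_le0 // => _ /(_ x0) ? *.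
by apply/andP; split; lra.
Qed.

(** Two regimes: up to size [d] the grid error [1 / (d + 1)] is at most [e]; beyond [d > 1 / e] the
    crude error, the size of the coordinate, is at most [e] times its square. *)
Lemma approx_code_cvg (e : R) : 0 < e -> exists k0, forall k, (k0 <= k)%N -> forall x i,
  `|approx_pt (code x) k ord0 i - x ord0 i| <= e * (1 + x ord0 i ^+ 2).
Proof.
(* This [l] makes the grid end at [l / (d + 1) = d]. *)
move=> e0; pose d := Num.bound e^-1; pose l := (d * d.+1)%N.
have de : e^-1 < d%:R by apply: archi_boundP; rewrite invr_ge0 ltW.
have dS : d.+1%:R^-1 <= e.
  rewrite -[e]invrK lef_pV2 ?posrE ?invr_gt0 ?ltr0n //.
  by apply: le_trans (ltW de) _; rewrite ler_nat.
have [k0 k0P] := approx_code_grid l d; exists k0 => k k0k x i.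
have [xl|lx] := leP `|x ord0 i| (l%:R / d.+1%:R).
  apply: le_trans (k0P k k0k x i xl) _; apply: le_trans dS _.
  by rewrite ler_pMr // lerDl sqr_ge0.
apply: le_trans (approx_code_err x k i) _.
move: lx; rewrite /l natrM mulfK ?pnatr_eq0 // => dx.
have := lt_trans de dx; rewrite -[x ord0 i ^+ 2]real_normK ?num_real //.
set a := `|_| => ea; have a0 : 0 <= a by exact: normr_ge0.
have ea1 : 1 <= e * a by rewrite mulrC -ler_pdivrMr // div1r ltW.
nra.
Qed.

End Thresholds.

(** * Functions of polynomial growth *)

Section Tempered.
Context {R : realType} {n : nat}.
Implicit Types (x z u v : 'rV[R]_n) (K : set 'rV[R]_n) (f g : 'rV[R]_n -> R^o).

Definition weight (N : nat) z : R := (1 + \sum_i z ord0 i ^+ 2) ^+ N.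

Lemma weight1_ge1 z : 1 <= 1 + \sum_i z ord0 i ^+ 2.
Proof. by rewrite lerDl sumr_ge0 // => i _; rewrite sqr_ge0. Qed.

Lemma weight_ge1 N z : 1 <= weight N z.
Proof. by rewrite exprn_ege1 // weight1_ge1. Qed.

Lemma weight_ge0 N z : 0 <= weight N z.
Proof. exact: le_trans ler01 (weight_ge1 N z). Qed.

Lemma weightD M N z : weight (M + N) z = weight M z * weight N z.
Proof. exact: exprD. Qed.

Lemma le_weight N z z' : (forall i, `|z ord0 i| <= `|z' ord0 i|) ->
  weight N z <= weight N z'.
Proof.
move=> zz'; rewrite lerXn2r ?nnegrE ?(le_trans ler01 (weight1_ge1 _)) //.
rewrite lerD2l ler_sum // => i _.
by rewrite -[leLHS]real_normK ?num_real // -[leRHS]real_normK ?num_real // lerXn2r ?nnegrE.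
Qed.

Lemma coord_le_weight z i : `|z ord0 i| <= weight 1 z.
Proof.
rewrite /weight expr1 (bigD1 i) //= addrA; apply: ler_wpDr.
  by rewrite sumr_ge0 // => j _; rewrite sqr_ge0.
rewrite -[z ord0 i ^+ 2]real_normK ?num_real //.
have := normr_ge0 (z ord0 i); nra.
Qed.

Definition weight_poly N : mpoly.mpoly n R :=
  (1 + \sum_i mpoly.mpolyX R (mpoly.mnm1 i) ^+ 2) ^+ N.

Lemma ev_weight_poly N x : ev (weight_poly N) x = weight N x.
Proof.
rewrite /ev /weight_poly rmorphXn rmorphD rmorph1 rmorph_sum /=.
by congr ((1 + _) ^+ N); apply: eq_bigr => i _; rewrite rmorphXn /= mpoly.mevalXU.
Qed.

(** Growth and Lipschitz constant are controlled by a common coordinatewise bound [z] of the two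
    points, so that one envelope serves for a whole sequence of approximations and its limit. *)
Definition tempered f := exists C N, 0 <= C /\ forall z u v,
  (forall i, `|u ord0 i| <= z ord0 i) -> (forall i, `|v ord0 i| <= z ord0 i) ->
  `|f u| <= C * weight N z /\
  `|f u - f v| <= C * weight N z * \sum_i `|u ord0 i - v ord0 i|.

Lemma tempered_dominated K f : tempered f -> dominated K f.
Proof.
move=> [C [N [C0 fP]]]; exists (C *: weight_poly N) => x _.
rewrite evZ ev_weight_poly.
have [||+ _] := fP (\row_i `|x ord0 i|) x x; try by move=> i; rewrite mxE.
move=> /le_trans; apply; rewrite ler_wpM2l // le_weight // => i.
by rewrite mxE normr_id.
Qed.

Lemma tempered_cst (a : R) : tempered (fun _ => a).
Proof.
exists `|a|, 0%N; split=> // z u v _ _; rewrite /weight expr0 mulr1; split=> //.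
by rewrite subrr normr0 mulr_ge0 // sumr_ge0.
Qed.

Lemma tempered_coord i : tempered (fun x => x ord0 i).
Proof.
exists 1, 1%N; split=> // z u v uz vz; rewrite mul1r; split.
  apply: le_trans (coord_le_weight z i); apply: le_trans (uz i) _; exact: ler_norm.
rewrite (bigD1 i) //= mulrDr; apply: ler_wpDr.
  by rewrite mulr_ge0 ?weight_ge0 // sumr_ge0.
by rewrite ler_peMl // weight_ge1.
Qed.

Lemma tempered_mul f g : tempered f -> tempered g -> tempered (fun x => f x * g x).
Proof.
move=> [C [M [C0 fP]]] [D [N [D0 gP]]].
(* The factor 2 accounts for the two terms of the product rule for differences. *)
exists (2 * (C * D)), (M + N)%N; split=> [|z u v uz vz]; first by rewrite !mulr_ge0.
have [fu fuv] := fP z u v uz vz; have [gu guv] := gP z u v uz vz.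
have [gv _] := gP z v v vz vz; rewrite weightD.
set S := \sum_i _ in fuv guv *; have S0 : 0 <= S by exact: sumr_ge0.
have W1 := weight_ge0 M z; have W2 := weight_ge0 N z.
set a := weight M z in fu fuv W1 *; set b := weight N z in gu guv gv W2 *.
have fg0 : `|f u * g u| <= C * a * (D * b).
  by rewrite normrM ler_pM.
split.
  apply: le_trans fg0 _; rewrite mulrACA [leRHS](_ : _ = 2 * (C * D * (a * b))); last by ring.
  have := mulr_ge0 (mulr_ge0 C0 D0) (mulr_ge0 W1 W2); lra.
rewrite (_ : f u * g u - f v * g v = f u * (g u - g v) + (f u - f v) * g v); last by ring.
apply: le_trans (ler_normD _ _) _; rewrite !normrM.
have h1 : `|f u| * `|g u - g v| <= C * a * (D * b * S) by rewrite ler_pM.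
have h2 : `|f u - f v| * `|g v| <= C * a * S * (D * b) by rewrite ler_pM.
apply: le_trans (lerD h1 h2) _; rewrite le_eqVlt; apply/orP; left; apply/eqP; ring.
Qed.

Lemma tempered_mono a : tempered (mono a).
Proof.
rewrite /mono; elim: (index_enum _) => [|i r IH].
  by under [X in tempered X]eq_fun do rewrite big_nil; exact: tempered_cst.
under [X in tempered X]eq_fun do rewrite big_cons.
apply: tempered_mul => //; elim: (mpoly.fun_of_multinom a i) => [|k IHk].
  by under [X in tempered X]eq_fun do rewrite expr0; exact: tempered_cst.
under [X in tempered X]eq_fun do rewrite exprS.
by apply: tempered_mul => //; exact: tempered_coord.
Qed.

(** A tent in the l1 distance, positive exactly at distance less than [e] from [c]. *)
Definition bump (c : 'rV[R]_n) (e : R) x : R :=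
  Num.max 0 (e - \sum_i `|x ord0 i - c ord0 i|).

Lemma tempered_bump c e : 0 <= e -> tempered (bump c e).
Proof.
move=> e0; exists (1 + e), 0%N; split=> [|z u v _ _]; first by rewrite addr_ge0.
rewrite /weight expr0 mulr1.
have S0 (w : 'rV[R]_n) : 0 <= \sum_i `|w ord0 i - c ord0 i| by exact: sumr_ge0.
split.
  rewrite ger0_norm; last by rewrite le_max lexx.
  rewrite ge_max addr_ge0 //=; have := S0 u; lra.
have duv (s t : 'rV[R]_n) : \sum_i `|s ord0 i - c ord0 i| <=
    \sum_i `|s ord0 i - t ord0 i| + \sum_i `|t ord0 i - c ord0 i|.
  by rewrite -big_split ler_sum // => i _; exact: ler_distD.
have := duv u v; have := duv v u.
under [X in _ <= X + _ -> _]eq_bigr do rewrite distrC.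
have d0 : 0 <= \sum_i `|u ord0 i - v ord0 i| by exact: sumr_ge0.
move: d0; set d := \sum_i `|u _ _ - _| => d0.
have dS : d <= (1 + e) * d by rewrite ler_peMl // lerDl.
move=> vu uv; apply: le_trans _ dS; rewrite /bump !maxEle ler_norml.
by repeat case: ifP; move=> *; apply/andP; split; lra.
Qed.

End Tempered.

(** * Positive functionals on dominated functions and their approximation *)

Section Functional.
Context {R : realType} {n : nat} (K : set 'rV[R]_n) (Lam : ('rV[R]_n -> R^o) -> R).
Hypothesis posLam : positive_on K Lam.
Implicit Types (x : 'rV[R]_n) (f g : 'rV[R]_n -> R^o).

Let domD f g : dominated K f -> dominated K g -> dominated K (fun x => f x + g x).
Proof. by have [_ + _] := linear_subspace_dominated K => /[apply] => /[apply]. Qed.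

Let domZ a f : dominated K f -> dominated K (fun x => a * f x).
Proof. by have [_ _ +] := linear_subspace_dominated K; exact. Qed.

Lemma functionalD f g : dominated K f -> dominated K g ->
  Lam (fun x => f x + g x) = Lam f + Lam g.
Proof. by case: posLam => [[+ _] _]; exact. Qed.

Lemma functionalZ a f : dominated K f -> Lam (fun x => a * f x) = a * Lam f.
Proof. by case: posLam => [[_ +] _]; exact. Qed.

Lemma functional_ge0 f : dominated K f -> (forall x, K x -> 0 <= f x) -> 0 <= Lam f.
Proof. by case: posLam => _; exact. Qed.

Lemma dominated_sum (I : Type) (r : seq I) (F : I -> 'rV[R]_n -> R^o) :
  (forall i, dominated K (F i)) -> dominated K (fun x => \sum_(i <- r) F i x).
Proof.
move=> dF; elim: r => [|i r IH].
  under eq_fun do rewrite big_nil.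
  exact: tempered_dominated (tempered_cst 0).
by under eq_fun do rewrite big_cons; exact: domD.
Qed.

Lemma functional_sum (I : Type) (r : seq I) (F : I -> 'rV[R]_n -> R^o) :
  (forall i, dominated K (F i)) ->
  Lam (fun x => \sum_(i <- r) F i x) = \sum_(i <- r) Lam (F i).
Proof.
move=> dF; elim: r => [|i r IH].
  under eq_fun do rewrite big_nil -(mul0r (0 : R)).
  rewrite big_nil functionalZ ?mul0r //.
  exact: tempered_dominated (tempered_cst 0).
under eq_fun do rewrite big_cons.
by rewrite functionalD ?big_cons ?IH //; exact: dominated_sum.
Qed.

Lemma functionalB f g : dominated K f -> dominated K g ->
  Lam (fun x => f x - g x) = Lam f - Lam g.
Proof.
move=> df dg; under eq_fun do rewrite -mulN1r.
by rewrite functionalD ?functionalZ ?mulN1r //; exact: domZ.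
Qed.

Lemma dominatedB f g : dominated K f -> dominated K g -> dominated K (fun x => f x - g x).
Proof. by move=> df dg; under eq_fun do rewrite -mulN1r; apply/domD/domZ. Qed.

Lemma functional_le f g : dominated K f -> dominated K g ->
  (forall x, K x -> f x <= g x) -> Lam f <= Lam g.
Proof.
move=> df dg fg; rewrite -subr_ge0 -functionalB //.
by apply: functional_ge0 => [|x Kx]; [exact: dominatedB | rewrite subr_ge0 fg].
Qed.

Lemma functional_norm_le f g : dominated K f -> dominated K g ->
  (forall x, K x -> `|f x| <= g x) -> `|Lam f| <= Lam g.
Proof.
move=> df dg fg; rewrite ler_norml -mulN1r -functionalZ //; apply/andP; split.
  apply: functional_le => // [|x /fg]; first exact: domZ.
  by rewrite ler_norml mulN1r => /andP[].
by apply: functional_le => // x /fg; rewrite ler_norml => /andP[].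
Qed.

Lemma dominated_weight N : dominated K (weight N).
Proof.
rewrite (_ : weight N = ev (weight_poly N)); first exact: dominated_ev.
by apply/funext => x; rewrite ev_weight_poly.
Qed.

Lemma dominated_bounded f (C : R) : (forall x, `|f x| <= C) -> dominated K f.
Proof.
move=> fC; exists (C *: 1) => x _; by rewrite evZ ev1 mulr1.
Qed.

(* The truncations [approx_pt (code x) k] converge to [x] at a rate that is
   uniform relative to [weight], so [Lam] passes to the limit although it is not
   assumed to be continuous in any sense. *)
Lemma functional_approx_cvg f : tempered f ->
  (fun k => Lam (fun x => f (approx_pt (code x) k))) @ \oo --> Lam f.
Proof.
move=> tf; have [C [N [C0 fP]]] := tf.
have zP x k i : `|approx_pt (code x) k ord0 i| <= (\row_j `|x ord0 j|) ord0 i.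
  rewrite mxE; exact: le_trans (normr_approx_le _ _ _) (envelope_code_le _ _ _).
have wz M x : weight M (\row_j `|x ord0 j|) <= weight M x.
  by apply: le_weight => i; rewrite mxE normr_id.
have dfk k : dominated K (fun x => f (approx_pt (code x) k)).
  apply: (@dominated_le _ _ _ _ (fun x => C * weight N x)).
    exact/domZ/dominated_weight.
  move=> x _; have [+ _] := fP _ _ _ (zP x k) (zP x k) => /le_trans; apply.
  by rewrite ger0_norm ?mulr_ge0 ?weight_ge0 // ler_wpM2l.
have df := tempered_dominated K tf.
(* Summing the error [d * (1 + x_i ^ 2)] over the coordinates gives at most
   [d * (n + 1) * weight 1 x]; the Lipschitz constant contributes [C * weight N x]. *)
pose B := C * (n%:R + 1) * Lam (weight (N + 1)).
have B0 : 0 <= B.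
  rewrite mulr_ge0 ?mulr_ge0 ?addr_ge0 //; apply: functional_ge0.
    exact: dominated_weight.
  by move=> x _; exact: weight_ge0.
have main (d : R) : 0 < d -> exists k0, forall k, (k0 <= k)%N ->
    `|Lam (fun x => f (approx_pt (code x) k)) - Lam f| <= d * B.
  move=> d0; have [k0 k0P] := @approx_code_cvg R n d d0; exists k0 => k k0k.
  rewrite -functionalB // /B mulrA -functionalZ; last exact: dominated_weight.
  apply: functional_norm_le; [exact: dominatedB|exact/domZ/dominated_weight|].
  move=> x _; have [|_] := fP _ (approx_pt (code x) k) x (zP x k).
    by move=> i; rewrite mxE.
  move=> /le_trans; apply.
  rewrite weightD mulrA [leRHS](_ : _ =
     C * weight N x * (d * ((n%:R + 1) * weight 1 x))); last by ring.
  apply: ler_pM; rewrite ?mulr_ge0 ?weight_ge0 ?sumr_ge0 //; first by rewrite ler_wpM2l.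
  apply: le_trans (ler_sum _ (fun i _ => k0P k k0k x i)) _.
  rewrite -mulr_sumr ler_wpM2l ?(ltW d0) // big_split /= sumr_const card_ord.
  rewrite /weight expr1 mulrDl mul1r; apply: lerD; last by rewrite lerDr.
  by rewrite ler_peMr // weight1_ge1.
(* [B] may vanish, hence the division by [B + 1]. *)
apply/cvgrPdist_le => e e0; have B1 : 0 < B + 1 by rewrite ltr_wpDl.
have [k0 k0P] := main (e / (B + 1)) (divr_gt0 e0 B1).
near=> k; rewrite distrC; apply: le_trans (k0P k _) _.
  by near: k; exact: nbhs_infty_ge.
by rewrite -mulrA ler_piMr ?(ltW e0) // ler_pdivrMl // mulr1 lerDl.
Unshelve. all: by end_near. Qed.

End Functional.

(** * The Borel structure of R^n *)

Section Borel.
Context {R : realType} {n : nat}.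
Implicit Types (x : 'rV[R]_n) (U : set 'rV[R]_n).

Definition rat_box (b : 'rV[rat]_n * nat) : set 'rV[R]_n :=
  [set x | forall i, `|x ord0 i - ratr (b.1 ord0 i)| < b.2.+1%:R^-1].

Lemma open_rat_box U x : open U -> U x -> exists2 b, rat_box b x & rat_box b `<=` U.
Proof.
move=> oU Ux; have /nbhs_ballP[e /= e0 eU] : nbhs x U by exact: open_nbhs_nbhs.
(* Points of the box and [x] are both within [1 / (m + 1)] of the rational centre, so twice this
   radius must not exceed [e]. *)
have [m m2] : exists m, 2 < m%:R * e.
  exists (Num.bound (2 / e)); rewrite -ltr_pdivrMr //.
  by apply: archi_boundP; rewrite divr_ge0 // ltW.
have me : m.+1%:R^-1 + m.+1%:R^-1 <= e.
  rewrite (_ : _ + _ = 2 / m.+1%:R); last by rewrite mulr_natl mulr2n.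
  rewrite ler_pdivrMr ?ltr0n // -[m.+1%:R]natr1 mulrDr mulr1 [e * _]mulrC.
  by move: m2; set a := m%:R * e => m2; lra.
have m0 : 0 < m.+1%:R^-1 :> R by rewrite invr_gt0 ltr0n.
have approx i : exists c : rat, `|x ord0 i - ratr c| < m.+1%:R^-1.
  have [c] := @rat_in_itvoo R (x ord0 i - m.+1%:R^-1) (x ord0 i + m.+1%:R^-1)
    ltac:(by move: m0; set a := m.+1%:R^-1 => m0; lra).
  rewrite in_itv /= => /andP[c1 c2]; exists c.
  move: c1 c2; set a := m.+1%:R^-1 => c1 c2.
  by rewrite ltr_norml; apply/andP; split; lra.
exists (\row_i sval (cid (approx i)), m) => [i|y yb].
  by rewrite mxE; exact: (svalP (cid (approx i))).
apply: eU; split=> // i j; rewrite (ord1 i) /ball /=; apply: lt_le_trans me.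
have := yb j; rewrite mxE /= distrC.
have := svalP (cid (approx j)); set c := sval _ => xc yc.
by apply: le_lt_trans (ler_distD (ratr c) _ _) _; exact: ltrD.
Qed.

Lemma measurable_coord i : measurable_fun setT (fun x : borelRn R n => x ord0 i).
Proof.
apply: (measurability _ (RGenOInfty.measurableE R)) => _ [_ [a ->] <-]; rewrite setTI.
apply: sub_gen_smallest.
apply: (@open_comp _ _ (fun x : 'rV[R]_n => x ord0 i)); last exact: interval_open.
by move=> x _; exact: coord_continuous.
Qed.

Lemma open_countable_bigcup U : open U ->
  U = \bigcup_k (if unpickle k is Some b then
                   if `[< rat_box b `<=` U >] then rat_box b else set0
                 else set0).
Proof.
move=> oU; apply/seteqP; split=> [x Ux|x [k _]].
  have [b xb bU] := open_rat_box oU Ux.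
  by exists (pickle b) => //; rewrite pickleK asboolT.
by case: unpickle => // b; case: ifP => // /asboolP; exact.
Qed.

Lemma measurable_rat_box_preimage d (T : measurableType d) (X : T -> 'rV[R]_n) b :
  (forall i, measurable_fun setT (fun t => X t ord0 i)) ->
  measurable (X @^-1` rat_box b).
Proof.
move=> mX; rewrite (_ : _ @^-1` _ = \bigcap_i
    ((fun t => X t ord0 i) @^-1` ball (ratr (b.1 ord0 i) : R) b.2.+1%:R^-1)).
  apply: fin_bigcap_measurable => // i _; rewrite -[X in measurable X]setTI.
  by apply: mX => //; exact: measurable_ball.
by apply/seteqP; split=> t /= tb i => [_|]; have := tb i; rewrite /ball /= distrC //; apply.
Qed.

(** Preimages of open sets suffice, and an open set is a countable union of rational boxes, which
    are described by coordinates. *)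
Lemma measurable_borelRn d (T : measurableType d) (X : T -> borelRn R n) :
  (forall i, measurable_fun setT (fun t => (X t : 'rV[R]_n) ord0 i)) ->
  measurable_fun setT X.
Proof.
move=> mX; apply: (@measurability _ _ T (borelRn R n) setT X (open : set (set 'rV[R]_n)) erefl).
move=> _ [U oU <-]; rewrite setTI [in X in measurable X](open_countable_bigcup oU).
rewrite preimage_bigcup; apply: bigcupT_measurable => k.
case: unpickle => [b|]; last by rewrite preimage_set0.
by case: ifP => _; [exact: measurable_rat_box_preimage|rewrite preimage_set0].
Qed.

(** A point outside the support has a null open neighbourhood, hence lies in a null rational box,
    and there are countably many such boxes. *)
Lemma negligible_setC_msupport (mu : {measure set (borelRn R n) -> \bar R}) :
  mu.-negligible (~` msupport mu).
Proof.
have mbox b : measurable (rat_box b : set (borelRn R n)).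
  rewrite -[rat_box b]/(id @^-1` rat_box b); apply: measurable_rat_box_preimage => i.
  exact: measurable_coord.
pose N k : set (borelRn R n) := if unpickle k is Some b then
  if mu (rat_box b) == 0%E then rat_box b else set0 else set0.
apply: (@negligibleS _ _ _ mu (\bigcup_k N k)); last first.
  apply: negligible_bigcup => k; rewrite /N; case: unpickle => [b|]; last exact: negligible_set0.
  by case: ifP => [/eqP b0|_]; [exact/negligibleP|exact: negligible_set0].
move=> x /=; rewrite /msupport /= => /existsNP[U /not_implyP[oU /not_implyP[Ux /negP]]].
rewrite -leNgt => U0; have [b xb bU] := open_rat_box oU Ux.
exists (pickle b) => //; rewrite /N pickleK.
suff -> : mu (rat_box b) = 0%E by rewrite eqxx.
apply/eqP; rewrite eq_le measure_ge0 andbT; apply: le_trans U0.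
by apply: le_measure; rewrite ?inE //; exact: sub_gen_smallest.
Qed.

End Borel.

(** * Representation of positive functionals *)

Lemma cvg_bigsum (R : realType) (I : Type) (r : seq I) (F : I -> nat -> R) (a : I -> R) :
  (forall i, F i k @[k --> \oo] --> a i) ->
  \sum_(i <- r) F i k @[k --> \oo] --> \sum_(i <- r) a i.
Proof.
move=> Fa; elim: r => [|i r IH].
  by under eq_fun do rewrite big_nil; rewrite big_nil; exact: cvg_cst.
by under eq_fun do rewrite big_cons; rewrite big_cons; exact: cvgD.
Qed.

Section Representation.
Context {R : realType} {n : nat} (K : set 'rV[R]_n) (Lam : ('rV[R]_n -> R^o) -> R).
Hypothesis posLam : positive_on K Lam.
Implicit Types (x : 'rV[R]_n) (t : measurableTypeR R) (f : 'rV[R]_n -> R^o).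

Definition mass (C : set 'rV[R]_n) : R := Lam (fun x => (\1_C x : R)).

Lemma dominated_indic (C : set 'rV[R]_n) : dominated K (fun x => (\1_C x : R)).
Proof.
by apply: (@dominated_bounded _ _ _ _ 1) => x; rewrite indicE; case: (_ \in _); rewrite ?normr1 ?normr0.
Qed.

Lemma mass_ge0 C : 0 <= mass C.
Proof. by apply: (functional_ge0 posLam) => [|x _]; [exact: dominated_indic|]. Qed.

Lemma mass_split C B : mass C = mass (C `&` B) + mass (C `\` B).
Proof.
rewrite /mass -(functionalD posLam); [|exact: dominated_indic..].
congr Lam; apply/funext => x; rewrite !indicE in_setI in_setD.
by case: (x \in C); case: (x \in B); rewrite /= ?addr0 ?add0r.
Qed.

Definition random_code t : nat -> bool := bit (@threshold_set R n) mass t.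

Definition code_measure := bit_measure mass.

HB.instance Definition _ := Measure.on code_measure.

Lemma measurable_random_code k (G : (nat -> bool) -> R) :
  (forall v w, agree k v w -> G v = G w) ->
  measurable_fun setT (fun t => G (random_code t)).
Proof. exact: measurable_fun_bit. Qed.

(** Both sides are the same finite sum over words of length [k], each weighted by the mass of its
    cell. *)
Lemma integral_random_code k (G : (nat -> bool) -> R) :
  (forall v w, agree k v w -> G v = G w) ->
  (\int[code_measure]_t (G (random_code t))%:E = (Lam (fun x => G (code x)))%:E)%E.
Proof.
move=> GE; rewrite (integral_bit (@threshold_set R n) mass_ge0 mass_split GE); congr EFin.
under [in RHS]eq_fun do rewrite -(sum_agree _ GE).
have dagree w : dominated K (fun x => (agree k (code x) w)%:R : R).
  by apply: (@dominated_bounded _ _ _ _ 1) => x; case: agree; rewrite ?normr1 ?normr0.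
rewrite (functional_sum posLam) => [|w]; last first.
  by have [_ _ +] := linear_subspace_dominated K; apply; exact: dagree.
apply: eq_bigr => w _; rewrite (functionalZ posLam) //; congr (_ * Lam _).
apply/funext => x; rewrite indicE; congr (_%:R); congr nat_of_bool.
apply/idP/idP => [/set_mem/cellP //|h]; apply/mem_set/cellP; exact: h.
Qed.

Definition part_lim t (i : 'I_n) s : \bar R := ereal_sup (range (fun k => (part (random_code t) k i s)%:E)).

Lemma part_lim_cvg t i s :
  (part (random_code t) k i s)%:E @[k --> \oo] --> part_lim t i s.
Proof.
by apply: ereal_nondecreasing_cvgn => j k jk; rewrite lee_fin part_nd.
Qed.

(** The limits of the parts may be infinite for some [t]; [fine] then gives 0. By integrability of
    [weight_lim 1] this happens on a null set only. *)
Definition random_pt t : 'rV[R]_n :=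
  \row_i (fine (part_lim t i true) - fine (part_lim t i false)).

Lemma measurable_part_lim i s : measurable_fun setT (fun t => part_lim t i s).
Proof.
apply: (emeasurable_fun_cvg (fun k t => (part (random_code t) k i s)%:E)) => [k|t _].
  apply/measurable_EFinP.
  apply: (@measurable_random_code k (fun w => part w k i s)) => v w.
  exact: eq_part.
exact: part_lim_cvg.
Qed.

Lemma measurable_random_pt : measurable_fun setT (random_pt : _ -> borelRn R n).
Proof.
apply: measurable_borelRn => i.
under eq_fun do rewrite mxE.
by apply: measurable_funB; apply: measurableT_comp => //; exact: measurable_part_lim.
Qed.

Lemma eq_approx_pt k v w : agree k v w -> approx_pt v k = approx_pt w k :> 'rV[R]_n.
Proof. by move=> vw; apply/rowP => i; rewrite !mxE !(eq_part _ _ vw). Qed.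

Lemma eq_envelope k v w : agree k v w -> envelope v k = envelope w k :> 'rV[R]_n.
Proof. by move=> vw; apply/rowP => i; rewrite !mxE !(eq_part _ _ vw). Qed.

Let W N k t : \bar R := (weight N (envelope (random_code t) k : 'rV[R]_n))%:E.

Let W_nd N t : {homo (fun k => W N k t) : j k / (j <= k)%N >-> (j <= k)%E}.
Proof.
move=> j k jk; rewrite lee_fin; apply: le_weight => i.
by rewrite !mxE !ger0_norm ?addr_ge0 ?part_ge0 // lerD // part_nd.
Qed.

Definition weight_lim N t : \bar R := ereal_sup (range (fun k => W N k t)).

Let W_cvg N t : W N k t @[k --> \oo] --> weight_lim N t.
Proof. exact/ereal_nondecreasing_cvgn/W_nd. Qed.

Let W_le N k t : (W N k t <= weight_lim N t)%E.
Proof. by apply: ereal_sup_ubound; exists k. Qed.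

Let measurable_W N k : measurable_fun setT (W N k).
Proof.
apply/measurable_EFinP.
apply: (@measurable_random_code k (fun w => weight N (envelope w k : 'rV[R]_n))) => v w.
by move=> /eq_envelope ->.
Qed.

(** Monotone convergence: the integral at level [k] is [Lam] of the weight of [envelope (code x) k],
    at most [Lam (weight N)] because the envelope of a code stays below the sizes of the
    coordinates. *)
Lemma integrable_weight_lim N : code_measure.-integrable setT (weight_lim N).
Proof.
have W0 k t : (0 <= W N k t)%E by rewrite lee_fin weight_ge0.
have mlim : measurable_fun setT (weight_lim N).
  by apply: (emeasurable_fun_cvg (W N)) => // t _; exact: W_cvg.
apply/integrableP; split => //.
under eq_integral => t _ do
  rewrite gee0_abs ?(le_trans (W0 0%N t)) // -(cvg_lim (@ereal_hausdorff R) (@W_cvg N t)).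
rewrite monotone_convergence //; try by move=> t _; exact: W_nd.
apply: (@le_lt_trans _ _ (Lam (weight N))%:E); last exact: ltry.
apply: lime_le.
  apply: ereal_nondecreasing_is_cvgn => j k jk; apply: ge0_le_integral => //.
  by move=> t _; exact: W_nd.
apply: nearW => k; rewrite (@integral_random_code k (fun w => weight N (envelope w k : 'rV[R]_n))).
  rewrite lee_fin; apply: (functional_le posLam).
  - apply: (dominated_le (dominated_weight K N)) => x _.
    rewrite !ger0_norm ?weight_ge0 //; apply: le_weight => i.
    rewrite ger0_norm ?envelope_code_le //.
    by rewrite mxE addr_ge0 // part_ge0.
  - exact: dominated_weight.
  - move=> x _; apply: le_weight => i.
    rewrite ger0_norm ?envelope_code_le //.
    by rewrite mxE addr_ge0 // part_ge0.
by move=> v w /eq_envelope ->.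
Qed.

(** Where [weight_lim 1] is finite, all parts are bounded, so their limits are finite and the
    approximations converge to [random_pt t]. The Lipschitz bound of [f] under the limiting envelope
    [z] does the rest. *)
Lemma approx_random_cvg f : tempered f -> {ae code_measure, forall t, setT t ->
  (f (approx_pt (random_code t) k))%:E @[k --> \oo] --> (f (random_pt t))%:E}.
Proof.
move=> [C [N [C0 fP]]].
apply: filterS (integrable_ae measurableT (integrable_weight_lim 1)) => t /(_ I) Wfin _.
have part_le k (i : 'I_n) s : part (random_code t) k i s <= fine (weight_lim 1 t).
  rewrite -lee_fin fineK //; apply: le_trans (W_le 1 k t); rewrite lee_fin.
  apply: le_trans (coord_le_weight _ i); rewrite mxE ger0_norm ?addr_ge0 ?part_ge0 //.
  by case: s; rewrite ?lerDl ?lerDr part_ge0.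
pose p i s := fine (part_lim t i s).
have pE i s : (p i s)%:E = part_lim t i s.
  rewrite fineK // ge0_fin_numE.
    apply: (@le_lt_trans _ _ (fine (weight_lim 1 t))%:E); last exact: ltry.
    by apply: ge_ereal_sup => _ [k _ <-]; rewrite lee_fin.
  by apply: ereal_sup_ubound; exists 0%N.
have pcvg i s : part (random_code t) k i s @[k --> \oo] --> p i s.
  by have := @part_lim_cvg t i s; rewrite -pE => /fine_cvg.
have part_p k i s : part (random_code t) k i s <= p i s.
  by rewrite -lee_fin pE; apply: ereal_sup_ubound; exists k.
have p0 i s : 0 <= p i s := le_trans (part_ge0 _ 0%N i s) (part_p _ _ _).
pose z : 'rV[R]_n := \row_i (p i true + p i false).
have zk k i : `|approx_pt (random_code t) k ord0 i| <= z ord0 i.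
  by apply: le_trans (normr_approx_le _ _ _) _; rewrite !mxE lerD.
have zp i : `|random_pt t ord0 i| <= z ord0 i.
  rewrite !mxE -!/(p _ _) ler_norml; have := p0 i true; have := p0 i false.
  by move=> ? ?; apply/andP; split; lra.
have dist_cvg i :
    `|approx_pt (random_code t) k ord0 i - random_pt t ord0 i| @[k --> \oo] --> (0 : R).
  have : approx_pt (random_code t) k ord0 i @[k --> \oo] --> random_pt t ord0 i.
    by under eq_fun do rewrite mxE; rewrite mxE; apply: cvgB; exact: pcvg.
  move=> /cvgrPdist_le c; apply/cvgrPdist_le => e e0; apply: filterS (c e e0) => k.
  by rewrite sub0r normrN normr_id distrC.
have dcvg : (C * weight N z * \sum_i
     `|approx_pt (random_code t) k ord0 i - random_pt t ord0 i|) @[k --> \oo] --> (0 : R).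
  rewrite -[X in _ --> X](mulr0 (C * weight N z)); apply: cvgM; first exact: cvg_cst.
  rewrite [X in _ --> X](_ : 0 = \sum_(i < n) 0); last by rewrite big1.
  exact: cvg_bigsum.
apply/fine_cvgP; split; first exact: nearW.
apply/cvgrPdist_le => e e0; near=> k; rewrite /= distrC.
have [_ /le_trans] := fP _ _ _ (zk k) zp; apply.
near: k; move/cvgrPdist_le: dcvg => /(_ e e0); apply: filterS => k.
by rewrite sub0r normrN ger0_norm ?mulr_ge0 ?weight_ge0 // sumr_ge0.
Unshelve. all: by end_near. Qed.

Definition random_law : {measure set (borelRn R n) -> \bar R} :=
  measure_function_pushforward__canonical__measure_function_Measure
    code_measure measurable_random_pt.

(** Dominated convergence with majorant [C * weight_lim N]. The integrals at level [k] are
    [Lam (fun x => f (approx_pt (code x) k))], which tend to [Lam f] by [functional_approx_cvg]. *)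
Lemma integral_random_law f : tempered f ->
  measurable_fun setT (f : borelRn R n -> R) ->
  random_law.-integrable setT (fun x : borelRn R n => (f x)%:E) /\
  (\int[random_law]_x (f x)%:E = (Lam f)%:E)%E.
Proof.
move=> tf mf; have [C [N [C0 fP]]] := tf.
have mfX : measurable_fun setT (fun t => (f (random_pt t))%:E).
  by apply/measurable_EFinP; exact: (measurableT_comp mf measurable_random_pt).
have mfk k : measurable_fun setT (fun t => (f (approx_pt (random_code t) k))%:E).
  apply/measurable_EFinP.
  apply: (@measurable_random_code k (fun w => f (approx_pt w k))) => v w.
  by move=> /eq_approx_pt ->.
have ig : code_measure.-integrable setT (fun t => C%:E * weight_lim N t)%E.
  by apply: integrableZl => //; exact: integrable_weight_lim.
have fle t k : (`|(f (approx_pt (random_code t) k))%:E| <= C%:E * weight_lim N t)%E.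
  apply: (@le_trans _ _ (C%:E * W N k t)%E); last first.
    by rewrite lee_wpmul2l ?lee_fin.
  rewrite -EFinM abse_EFin lee_fin.
  by have [||+ _] := fP (envelope (random_code t) k)
    (approx_pt (random_code t) k) (approx_pt (random_code t) k); move=> *; rewrite ?normr_approx_le.
have [ifX _] := dominated_convergence measurableT mfk mfX (approx_random_cvg tf) ig
  (aeW _ (fun t k _ => fle t k)).
under [X in X @ _ --> _]eq_fun => k.
  rewrite /= (@integral_random_code k (fun w => f (approx_pt w k))); last first.
    by move=> v w /eq_approx_pt ->.
  over.
move=> cvgI.
have EX : (\int[code_measure]_t (f (random_pt t))%:E = (Lam f)%:E)%E.
  apply: (cvg_unique (@ereal_hausdorff R) cvgI); apply/fine_cvgP; split; first exact: nearW.
  exact: (functional_approx_cvg posLam tf).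
split.
  by apply: (integrable_pushforward measurable_random_pt) => //; exact/measurable_EFinP.
rewrite -EX (integral_pushforward measurable_random_pt) //; exact/measurable_EFinP.
Qed.

End Representation.

(** * Translation and differentiation of polynomials *)

Section Translation.
Context {R : realType} {n : nat}.
Implicit Types (p q f g : mpoly.mpoly n R) (x y : 'rV[R]_n) (a b : mpoly.multinom n).

Local Notation msize := (mpoly.mmeasure mpoly.mdeg).

Lemma ev_sum (I : Type) (r : seq I) (P : pred I) (F : I -> mpoly.mpoly n R) x :
  ev (\sum_(i <- r | P i) F i) x = \sum_(i <- r | P i) ev (F i) x.
Proof. by rewrite /ev raddf_sum. Qed.

Lemma ev_mpolyX a x : ev (mpoly.mpolyX R a) x = mono a x.
Proof. exact: mpoly.mevalX. Qed.

(** Brings sums truncated at the degrees of different polynomials to a common bound. *)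
Lemma sum_bmultinom_widen (V : nmodType) k w (F : mpoly.multinom n -> V) : (k <= w)%N ->
  (forall a, (k <= mpoly.mdeg a)%N -> F a = 0) ->
  \sum_(a : mpoly.bmultinom n k) F (mpoly.bmnm a) =
  \sum_(a : mpoly.bmultinom n w) F (mpoly.bmnm a).
Proof.
move=> kw F0.
rewrite (@ssrcomplements.big_sub_widen _ _ _ _ _ _ (mpoly.bmultinom n k)
  (mpoly.bmultinom n w) predT F) /=.
  by rewrite big_mkcond; apply: eq_bigr => a _; case: ltnP => // /F0.
by move=> a ak; exact: leq_trans ak kw.
Qed.

Lemma mcoeff_ge_msize p a : (msize p <= mpoly.mdeg a)%N -> mpoly.mcoeff a p = 0.
Proof. by move=> pa; apply/eqP; rewrite mpoly.mcoeff_eq0 mpoly.msize_mdeg_ge. Qed.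

Lemma mderivm_ge_msize p a : (msize p <= mpoly.mdeg a)%N -> mpoly.mderivm a p = 0.
Proof.
move=> pa; apply/mpoly.mpolyP => b; rewrite mpoly.mcoeff_mderivm mpoly.mcoeff0.
by rewrite mcoeff_ge_msize ?mul0rn // mpoly.mdegD (leq_trans pa) // leq_addr.
Qed.

Lemma ev_at0 p : ev p 0 = mpoly.mcoeff (@mpoly.mnm0 n) p.
Proof.
rewrite /ev mpoly.mevalE [X in mpoly.mcoeff _ X]mpoly.mpolyE raddf_sum /=.
apply: eq_bigr => m _; rewrite mpoly.mcoeffZ mpoly.mcoeffX; congr (_ * _).
case: eqP => [->|m0]; first by rewrite big1 // => i _; rewrite mpoly.mnm0E.
have [i mi] : exists i, mpoly.fun_of_multinom m i != 0%N.
  apply/existsP; apply: contra_notT m0 => /existsPn mi.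
  by apply/mpoly.mnmP => i; rewrite mpoly.mnm0E; apply/eqP; move: (mi i); rewrite negbK.
by rewrite (bigD1 i) //= mxE expr0n (negbTE mi) mul0r.
Qed.

Lemma ev_mderivm0 a p : ev (mpoly.mderivm a p) 0 = (mfact a)%:R * mpoly.mcoeff a p.
Proof.
rewrite ev_at0 mpoly.mcoeff_mderivm mpoly.addm0 mulr_natl.
by congr (_ *+ _); apply: eq_bigr => i _; rewrite ffactnn.
Qed.

Definition shift_poly y p : mpoly.mpoly n R :=
  mpoly.comp_mpoly [tuple mpoly.mpolyX R (mpoly.mnm1 i) + mpoly.mpolyC n (y ord0 i) | i < n] p.

Lemma ev_shift_poly y p x : ev (shift_poly y p) x = ev p (x + y).
Proof.
rewrite /ev /shift_poly mpoly.comp_mpoly_meval; apply: mpoly.meval_eq => i.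
by rewrite tnth_mktuple mxE mpoly.mevalD mpoly.mevalXU mpoly.mevalC.
Qed.

(** The identity holds for 1 and the variables and passes to products by the Leibniz rule, hence
    holds for monomials; linearity concludes. *)
Lemma mderiv_shift_poly i y p :
  mpoly.mderiv i (shift_poly y p) = shift_poly y (mpoly.mderiv i p).
Proof.
have shiftM f g : shift_poly y (f * g) = shift_poly y f * shift_poly y g by exact: rmorphM.
have shiftD f g : shift_poly y (f + g) = shift_poly y f + shift_poly y g by exact: rmorphD.
pose P f := mpoly.mderiv i (shift_poly y f) = shift_poly y (mpoly.mderiv i f).
have P1 : P 1.
  by rewrite /P /shift_poly rmorph1 -mpoly.mpolyC1 !mpoly.mderivC rmorph0.
have PM f g : P f -> P g -> P (f * g).
  by rewrite /P => Pf Pg; rewrite shiftM !mpoly.mderivM shiftD !shiftM Pf Pg.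
have PX j : P (mpoly.mpolyX R (mpoly.mnm1 j)).
  rewrite /P /shift_poly mpoly.comp_mpolyXU -tnth_nth tnth_mktuple.
  rewrite mpoly.mderivD mpoly.mderivC addr0 mpoly.mderivX mpoly.comp_mpolyZ mpoly.mnm1E.
  case: eqP => [->|_]; last by rewrite !scale0r.
  rewrite (_ : mpoly.mnm_sub _ _ = @mpoly.mnm0 n); last first.
    by apply/mpoly.mnmP => l; rewrite mpoly.mnmBE subnn mpoly.mnm0E.
  by rewrite mpoly.mpolyX0 mpoly.comp_mpoly1.
elim/mpoly.mpolyind: p => [|c m p _ _ IH]; first by rewrite /shift_poly !(raddf0, linear0).
rewrite !mpoly.mderivD !shiftD mpoly.mderivD IH; congr (_ + _).
rewrite mpoly.mderivZ /shift_poly !mpoly.comp_mpolyZ mpoly.mderivZ; congr (_ *: _).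
rewrite -!/(shift_poly _ _) -/(P _) mpoly.mpolyXE_id.
elim/big_ind: _ => // j _; elim: (mpoly.fun_of_multinom m j) => [|k IHk]; first by rewrite expr0.
by rewrite exprS; exact: PM.
Qed.

Lemma mderivm_shift_poly a y p :
  mpoly.mderivm a (shift_poly y p) = shift_poly y (mpoly.mderivm a p).
Proof.
rewrite !mpoly.mderivm_foldr; elim: flatten => //= i s ->.
exact: mderiv_shift_poly.
Qed.

Lemma ev_bmultinom w p x : (msize p <= w)%N ->
  ev p x = \sum_(a : mpoly.bmultinom n w) mpoly.mcoeff (mpoly.bmnm a) p * mono (mpoly.bmnm a) x.
Proof.
move=> pw; rewrite {1}(mpoly.mpolywE pw) ev_sum; apply: eq_bigr => a _.
by rewrite evZ ev_mpolyX.
Qed.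

Lemma mfact_neq0 a : (mfact a)%:R != 0 :> R.
Proof.
by rewrite pnatr_eq0 -lt0n; apply: prodn_gt0 => i; exact: fact_gt0.
Qed.

(** Taylor's formula: a coefficient of the shifted polynomial is read off its derivative at 0, which
    is the derivative of [p] at [y]. *)
Lemma ev_translate p x y : ev p (x + y) = \sum_(a : mpoly.bmultinom n (msize p))
  ev (mpoly.mderivm (mpoly.bmnm a) p) y / (mfact (mpoly.bmnm a))%:R * mono (mpoly.bmnm a) x.
Proof.
(* A common truncation spares the proof that shifting preserves the degree. *)
pose w := maxn (msize p) (msize (shift_poly y p)).
rewrite -ev_shift_poly (@ev_bmultinom w) ?leq_maxr //.
pose F a := ev (mpoly.mderivm a p) y / (mfact a)%:R * mono a x.
rewrite (@sum_bmultinom_widen _ _ w F) ?leq_maxl // => [|a pa]; last first.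
  by rewrite /F mderivm_ge_msize // ev0 !mul0r.
apply: eq_bigr => a _; rewrite /F -[y in RHS]add0r -ev_shift_poly -mderivm_shift_poly.
by rewrite ev_mderivm0 [X in X / _]mulrC mulfK // mfact_neq0.
Qed.

Lemma ev_Top (q : mpoly.multinom n -> mpoly.mpoly n R) f y : ev (Top q f) y = ev (Ty q y f) y.
Proof.
by rewrite !ev_sum; apply: eq_bigr => a _; rewrite evM evZ.
Qed.

Lemma ev_Ty_widen (q : mpoly.multinom n -> mpoly.mpoly n R) y f w x : (msize f <= w)%N ->
  ev (Ty q y f) x = \sum_(a : mpoly.bmultinom n w)
    ev (q (mpoly.bmnm a)) y * ev (mpoly.mderivm (mpoly.bmnm a) f) x.
Proof.
move=> fw; pose F a := ev (q a) y * ev (mpoly.mderivm a f) x.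
rewrite ev_sum -(@sum_bmultinom_widen _ _ w F fw) => [|a fa]; last first.
  by rewrite /F mderivm_ge_msize // ev0 mulr0.
by apply: eq_bigr => a _; rewrite evZ.
Qed.

End Translation.

(** * The Riesz functional of a sequence, sending [x^a] to [s a] *)

Section MomentFunctional.
Context {R : realType} {n : nat} (s : mpoly.multinom n -> R).
Implicit Types (p q : mpoly.mpoly n R).

Local Notation msize := (mpoly.mmeasure mpoly.mdeg).

Definition moment_functional p : R := \sum_(a : mpoly.bmultinom n (msize p))
  mpoly.mcoeff (mpoly.bmnm a) p * s (mpoly.bmnm a).

Lemma moment_functional_widen w p : (msize p <= w)%N -> moment_functional p =
  \sum_(a : mpoly.bmultinom n w) mpoly.mcoeff (mpoly.bmnm a) p * s (mpoly.bmnm a).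
Proof.
move=> pw; apply: (@sum_bmultinom_widen _ _ _ _ (fun a => mpoly.mcoeff a p * s a)) => // a pa.
by rewrite mcoeff_ge_msize // mul0r.
Qed.

Lemma moment_functionalD p q :
  moment_functional (p + q) = moment_functional p + moment_functional q.
Proof.
pose w := maxn (msize (p + q)) (maxn (msize p) (msize q)).
rewrite !(@moment_functional_widen w) ?leq_max ?leqnn ?orbT // -big_split.
by apply: eq_bigr => a _; rewrite mpoly.mcoeffD mulrDl.
Qed.

Lemma moment_functionalZ c p : moment_functional (c *: p) = c * moment_functional p.
Proof.
pose w := maxn (msize (c *: p)) (msize p).
rewrite !(@moment_functional_widen w) ?leq_max ?leqnn ?orbT // mulr_sumr.
by apply: eq_bigr => a _; rewrite mpoly.mcoeffZ mulrA.
Qed.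

Lemma moment_functionalX a : moment_functional (mpoly.mpolyX R a) = s a.
Proof.
have aw : (mpoly.mdeg a < (mpoly.mdeg a).+1)%N by [].
rewrite (@moment_functional_widen (mpoly.mdeg a).+1) ?mpoly.mmeasureX //.
rewrite (bigD1 (mpoly.BMultinom aw)) //= mpoly.mcoeffX eqxx mul1r big1 ?addr0 // => b ba.
rewrite mpoly.mcoeffX (_ : (_ == _) = false) ?mul0r //.
by apply: contraNF ba => /eqP ab; apply/eqP/val_inj.
Qed.

End MomentFunctional.

(** * Haviland's theorem and the main result *)

Section Haviland.
Context {R : realType} {n : nat}.
Implicit Types (x y : 'rV[R]_n) (K : set 'rV[R]_n) (a : mpoly.multinom n).

Lemma measurable_mono a : measurable_fun setT (mono a : borelRn R n -> R).
Proof.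
apply: measurable_prod => i _; apply: measurable_funX; exact: measurable_coord.
Qed.

Lemma measurable_bump (c : 'rV[R]_n) e : measurable_fun setT (bump c e : borelRn R n -> R).
Proof.
apply: measurable_maxr => //; apply: measurable_funB => //.
apply: measurable_sum => i; apply: measurableT_comp => //.
by apply: measurable_funB => //; exact: measurable_coord.
Qed.

Lemma bump_vanish K x : closed K -> ~ K x ->
  exists2 e, 0 < e & forall y, K y -> bump x e y = 0.
Proof.
move=> cK Kx; have /nbhs_ballP[e /= e0 eK] : nbhs x (~` K).
  by apply: open_nbhs_nbhs; split=> //; exact: closed_openC.
(* A positive bump would put [y] at l1 distance less than [e] from [x], hence in the sup ball, which
   avoids [K]. *)
exists e => // y Ky; apply/max_idPl; rewrite subr_le0 leNgt; apply/negP => ye.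
apply: (eK y) => //; split=> // i j; rewrite (ord1 i) /ball /= distrC.
apply: le_lt_trans ye; rewrite (bigD1 j) //= lerDl sumr_ge0 //.
Qed.

Lemma bump_gt0 x e y : 0 < e -> ball x (e / n.+1%:R) y -> 0 < bump x e y.
Proof.
move=> e0 [d0 xy]; rewrite lt_max; apply/orP; right; rewrite subr_gt0.
(* Dividing by [n + 1] makes the sum of [n] terms strictly less than [e], also when [n = 0]. *)
apply: (@le_lt_trans _ _ (\sum_(i < n) (e / n.+1%:R))).
  by apply: ler_sum => i _; rewrite distrC ltW //; exact: xy.
rewrite sumr_const card_ord -[_ *+ n]mulr_natr mulrAC ltr_pdivrMr ?ltr0n //.
by rewrite ltr_pM2l // ltr_nat.
Qed.

(** For the support: a bump at [x] outside [K] vanishes on [K], so its integral, the value of [Lam],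
    is 0. It is positive near [x], so some neighbourhood of [x] is null. *)
Lemma haviland K (L : mpoly.mpoly n R -> R) : closed K ->
  (forall p q, L (p + q) = L p + L q) -> (forall c p, L (c *: p) = c * L p) ->
  (forall p, Pos K p -> 0 <= L p) ->
  is_moment_seq K (fun a => L (mpoly.mpolyX R a)).
Proof.
move=> cK LD LZ L_ge0.
have [Lam posLam LamE] := positive_extension LD LZ L_ge0.
exists (random_law Lam); split; last first.
  have mono_int a := integral_random_law posLam (tempered_mono a) (measurable_mono a).
  split=> a; first exact: (mono_int a).1.
  rewrite (mono_int a).2 -LamE; congr ((Lam _)%:E).
  by apply/funext => x; rewrite ev_mpolyX.
move=> x; apply: contraPP => Kx; have [e e0 eK] := bump_vanish cK Kx.
have tb : tempered (bump x e) by apply: tempered_bump; exact: ltW.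
have [_] := integral_random_law posLam tb (measurable_bump x e).
have -> : Lam (bump x e) = 0.
  have db := tempered_dominated K tb; have d0 := tempered_dominated K (tempered_cst (0:R)).
  have L0 : Lam (fun=> 0) = 0.
    by have := functionalZ posLam 0 d0; under eq_fun do rewrite mul0r; rewrite mul0r.
  by apply/eqP; rewrite eq_le -L0 !(functional_le posLam) // => y /eK ->.
move=> int0 /(_ (ball x (e / n.+1%:R))° (@open_interior _ _)).
have xU : (ball x (e / n.+1%:R))° x by apply: nbhsx_ballx; rewrite divr_gt0 ?ltr0n.
move=> /(_ xU); apply/negP; rewrite -leNgt.
set U := interior _; have mU : measurable (U : set (borelRn R n)).
  by apply: sub_gen_smallest; exact: open_interior.
suff /negligibleP -> : (random_law Lam).-negligible (U : set (borelRn R n)) by [].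
have mb : measurable_fun setT (fun y : borelRn R n => (bump x e y)%:E).
  apply/measurable_EFinP; exact: measurable_bump.
have [+ _] := ae_eq_integral_abs (random_law Lam) measurableT mb.
have -> : (\int[random_law Lam]_y `|(bump x e y)%:E| = 0)%E.
  rewrite -[RHS]int0; apply: eq_integral => y _.
  by rewrite /= ger0_norm // /bump le_max lexx.
move=> /(_ erefl); apply: negligibleS => y Uy /= /(_ I) /= [] /eqP.
by rewrite gt_eqF // bump_gt0 //; exact: interior_subset Uy.
Qed.

(** Taylor's formula turns the integrand into a finite combination of monomials in [x]; the factor
    [a!] of the moments cancels the Taylor denominator. *)
Lemma represents_integral_translate (K : set 'rV[R]_n) q y
    (mu : {measure set (borelRn R n) -> \bar R}) f :
  represents K (qseq q y) mu ->
  (ev (Ty q y f) y)%:E = (\int[mu]_x (ev f (x + y))%:E)%E.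
Proof.
move=> [_ [intm sE]].
pose c a := ev (mpoly.mderivm a f) y / (mfact a)%:R.
under eq_integral do rewrite ev_translate -sumEFin.
under eq_integral do under eq_bigr do rewrite EFinM.
rewrite -[RHS]/(\int[mu]_x \sum_(a : mpoly.bmultinom n (mpoly.mmeasure mpoly.mdeg f))
  ((c (mpoly.bmnm a))%:E * (mono (mpoly.bmnm a) x)%:E))%E.
rewrite integral_sum // => [|a]; last by apply: integrableZl => //; exact: intm.
rewrite ev_sum -sumEFin; apply: eq_bigr => a _.
rewrite integralZl //.
rewrite -sE evZ -EFinM; congr EFin.
by rewrite /qseq /c mulrA divfK ?mfact_neq0 // mulrC.
Qed.

End Haviland.

(** * The two implications between positivity preservation and moment sequences *)

Section Directions.
Context {R : realType} {n : nat}.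
Implicit Types (x y : 'rV[R]_n) (K : set 'rV[R]_n).

Lemma closed_translate K y : closed K -> closed (translate K y).
Proof.
have -> : translate K y = (fun x => x + y) @^-1` K.
  apply/seteqP; split=> x /=; first by move=> [z Kz <-]; rewrite subrK.
  by move=> Kxy; exists (x + y); rewrite ?addrK.
apply: (@closed_comp _ _ (fun x : 'rV[R]_n => x + y)) => x _.
by apply: continuousD; [exact: cvg_id | exact: cst_continuous].
Qed.

Lemma measurable_ev_translate f y :
  measurable_fun setT (fun x : borelRn R n => ev f ((x : 'rV[R]_n) + y)).
Proof.
under eq_fun do rewrite ev_translate.
apply: measurable_sum => a; apply: measurable_funM => //; exact: measurable_mono.
Qed.

(** For [x] in the support, [x + y] lies in [K]; the integrand thus equals its absolute value off a
    null set. *)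
Lemma moment_seq_pos_preserver K q :
  (forall y, K y -> is_moment_seq (translate K y) (qseq q y)) -> pos_preserver K (Top q).
Proof.
move=> Kq f f_ge0 y Ky; have [mu repr] := Kq y Ky; have [supp _] := repr.
rewrite ev_Top -lee_fin (represents_integral_translate f repr).
rewrite (_ : (\int[mu]_x _ = \int[mu]_x `|(ev f ((x : 'rV[R]_n) + y))%:E|)%E).
  exact: integral_ge0.
have mev := measurable_ev_translate f y.
apply: ae_eq_integral => //; [exact/measurable_EFinP|..].
  by apply: measurableT_comp => //; exact/measurable_EFinP.
apply: negligibleS (negligible_setC_msupport mu) => x /= /not_implyP[_ xf] /supp[z Kz zx].
by apply: xf; rewrite /= ger0_norm // -zx subrK; exact: f_ge0.
Qed.

(** If [p] is nonnegative on [K - y], its translate [g] is so on [K]. The derivatives of [g] at [y]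
    are those of [p] at 0, that is [a!] times the coefficients, so the value of [Top q g] at [y] is
    the Riesz functional at [p]. *)
Lemma pos_preserver_moment_seq K q y : closed K -> pos_preserver K (Top q) -> K y ->
  is_moment_seq (translate K y) (qseq q y).
Proof.
move=> cK pq Ky.
rewrite (_ : qseq q y = fun a => moment_functional (qseq q y) (mpoly.mpolyX R a)); last first.
  by apply/funext => a; rewrite moment_functionalX.
apply: haviland; [exact: closed_translate|exact: moment_functionalD|exact: moment_functionalZ|].
move=> p p_ge0; pose g := shift_poly (- y) p.
have /pq/(_ y Ky) : Pos K g.
  by move=> x Kx; rewrite /g ev_shift_poly; apply: p_ge0; exists x.
pose w := maxn (mpoly.mmeasure mpoly.mdeg p) (mpoly.mmeasure mpoly.mdeg g).
rewrite ev_Top (@ev_Ty_widen _ _ _ _ _ w) ?leq_maxr //.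
rewrite (@moment_functional_widen _ _ _ w) ?leq_maxl //.
congr (0 <= _); apply: eq_bigr => a _.
rewrite mderivm_shift_poly ev_shift_poly subrr ev_mderivm0 /qseq; ring.
Qed.

End Directions.

Theorem theorem4p5 (R : realType) (n : nat) (K : set 'rV[R]_n)
  (q : mpoly.multinom n -> mpoly.mpoly n R) :
  K !=set0 -> closed K ->
  (pos_preserver K (Top q) <->
     (forall y, K y -> is_moment_seq (translate K y) (qseq q y))) /\
  ((pos_preserver K (Top q) \/
      (forall y, K y -> is_moment_seq (translate K y) (qseq q y))) ->
   forall y, K y ->
   forall mu : {measure set (borelRn R n) -> \bar R},
     represents (translate K y) (qseq q y) mu ->
     forall f : mpoly.mpoly n R,
       (ev (Ty q y f) y)%:E = (\int[mu]_x (ev f (x + y))%:E)%E).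
Proof.
move=> _ cK; split; last by move=> _ y _ mu repr f; exact: represents_integral_translate repr.
split=> [pq y Ky|]; first exact: pos_preserver_moment_seq.
exact: moment_seq_pos_preserver.
Qed.
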